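(* Let $n\ge 1$ and consider the single-input plant with measurable state $x\in\mathbb{R}^n$ $$\dot x=(A_m-b\theta^\top)x+bu,$$ where $b=e_n$ is the $n$-th vector of the Euclidean basis of $\mathbb{R}^n$, $A_m\in\mathbb{R}^{n\times n}$ is a known Hurwitz matrix in companion form (ones on the superdiagonal, last row $(-a_1^m,\dots,-a_n^m)$ with $a_i^m>0$, zeros elsewhere), and $\theta\in\mathbb{R}^n$ is a vector of unknown constant parameters. (a) The classical state-feedback model reference controller $$u=\theta^\top x+r$$ is not a PIRC. (b) Let $F(p)=N_f(p)/D_f(p)$, with $p=\frac{d}{dt}$, be any strictly proper, stable real rational filter, where $N_f$ and $D_f$ are coprime real polynomials of degrees $n_{N_f}<n_{D_f}$ with designer-chosen (i.e. $\theta$-independent) coefficients. Let $(A_f,b_f,c_f)$ be a $\theta$-independent state realization of $F$ of order $n_\xi=n_{D_f}$, i.e. $F(p)=c_f^\top(pI-A_f)^{-1}b_f$. Then the filtered state-feedback model reference controller $$\dot\xi=A_f\xi+b_f(\theta^\top x+r),\qquad u=c_f^\top\xi,$$ is a PIRC.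
   Context: Definition of PIRC (controller admitting a parameter-independent realization). Consider a linear time-invariant (LTI) plant $\dot x=A(\theta)x+B(\theta)u$, $y=C(\theta)x$ with state $x\in\mathbb{R}^n$, depending on a constant parameter vector $\theta$, and an LTI controller with state $\xi\in\mathbb{R}^{n_\xi}$ (with $n_\xi=0$ for a static controller), inputs $y$ and an external reference $r$, output $u$, and coefficient matrices that may depend on $\theta$. Their feedback interconnection has a closed-loop transfer matrix $P_{cl}(s,\theta)$ from $r$ to $y$, i.e. $Y(s)=P_{cl}(s,\theta)R(s)$. The controller is a PIRC if there exists a partial change of coordinates $$\chi=T(\theta)\begin{bmatrix}x\\ \xi\end{bmatrix},\qquad T(\theta)\in\mathbb{R}^{n_\xi\times(n+n_\xi)}$$ (so that $(x,\xi)\mapsto(x,\chi)$ is invertible), such that: (i) the controller in the coordinates $\chi$ is independent of $\theta$: along the closed-loop system, $\dot\chi=\hat A\chi+\hat B\begin{bmatrix}y\\ r\end{bmatrix}$ and $u=\hat C\chi+\hat D\begin{bmatrix}y\\ r\end{bmatrix}$ with matrices $\hat A,\hat B,\hat C,\hat D$ that do not depend on $\theta$ (for a static controller, only the output map for $u$ is present); (ii) the closed-loop transfer matrix $P_{cl}(s,\theta)$ remains invariant. ''Independent of $\theta$'' means the same matrices serve for all values $\theta\in\mathbb{R}^n$ of the unknown parameter. In the state-feedback setting the plant output available to the controller is $y=x$. The reference $r$ is a bounded real-valued signal. *)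

(* Defs.v *)
From mathcomp Require Import all_boot all_order all_algebra.
From mathcomp Require Import fraction complex.
From mathcomp Require Import all_classical all_reals all_analysis.

Set Implicit Arguments.
Unset Strict Implicit.
Unset Printing Implicit Defensive.

Import Order.TTheory GRing.Theory Num.Theory.
Import numFieldNormedType.Exports.

Local Open Scope classical_set_scope.
Local Open Scope ring_scope.

(* x' = pA x + pB u, y = pC x, with m inputs, p outputs and n states *)
Record plant (R : realType) (m p n : nat) := Plant {
  pA : 'M[R]_n;
  pB : 'M[R]_(n, m);
  pC : 'M[R]_(p, n) }.

(* xi' = kA xi + kB [y; r], u = kC xi + kD [y; r], with plant outputs y (p),
   references r (q), outputs u (m) and k states; the static case is k = 0 *)
Record controller (R : realType) (p q m k : nat) := Controller {
  kA : 'M[R]_k;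
  kB : 'M[R]_(k, p + q);
  kC : 'M[R]_(m, k);
  kD : 'M[R]_(m, p + q) }.

Definition ratfun (R : realType) := {fraction {poly R}}.

Definition rat_poly (R : realType) (f : {poly R}) : ratfun R :=
  FracField.tofrac f.

Definition rat_mx (R : realType) (m n : nat) (M : 'M[R]_(m, n)) :
    'M[ratfun R]_(m, n) :=
  map_mx (fun a => rat_poly a%:P) M.

(* C (s I - A)^-1 B as a matrix of rational functions of s = 'X; the matrix
   s I - A is always invertible there since its determinant is char_poly A *)
Definition transfer (R : realType) (m p n : nat) (P : plant R m p n) :
    'M[ratfun R]_(p, m) :=
  rat_mx (pC P) *m invmx ((rat_poly 'X)%:M - rat_mx (pA P)) *m rat_mx (pB P).

(* The system with input r, output y and state [x; xi] obtained by eliminating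
   u; lsubmx and rsubmx split kB and kD into their y and r columns. *)
Definition closed_loop (R : realType) (m p q n k : nat)
    (P : plant R m p n) (K : controller R p q m k) : plant R q p (n + k) :=
  Plant
    (block_mx (pA P + pB P *m lsubmx (kD K) *m pC P) (pB P *m kC K)
              (lsubmx (kB K) *m pC P)                (kA K))
    (col_mx (pB P *m rsubmx (kD K)) (rsubmx (kB K)))
    (row_mx (pC P) 0).

(* x' = v on the time axis [0, +oo[: x is continuous and the equation holds for
   all t > 0 outside a countable set, which accommodates references with jumps *)
Definition evolves (R : realType) (n : nat) (x v : R -> 'cV[R]_n) : Prop :=
  (forall i, {within `[0, +oo[, continuous (fun t => x t i ord0)}) /\
  exists E : set R, countable E /\
    forall (i : 'I_n) (t : R), 0 < t -> ~ E t ->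
      is_derive t 1 (fun s => x s i ord0) (v t i ord0).

Definition bounded_signal (R : realType) (q : nat) (r : R -> 'cV[R]_q) : Prop :=
  exists M : R, forall (t : R) (i : 'I_q), 0 <= t -> `|r t i ord0| <= M.

Definition controlled (R : realType) (p q m k : nat) (K : controller R p q m k)
    (y : R -> 'cV[R]_p) (r : R -> 'cV[R]_q)
    (xi : R -> 'cV[R]_k) (u : R -> 'cV[R]_m) : Prop :=
  evolves xi (fun t => kA K *m xi t + kB K *m col_mx (y t) (r t)) /\
  (forall t, 0 <= t -> u t = kC K *m xi t + kD K *m col_mx (y t) (r t)).

Definition closed_loop_motion (R : realType) (m p q n k : nat)
    (P : plant R m p n) (K : controller R p q m k) (r : R -> 'cV[R]_q)
    (x : R -> 'cV[R]_n) (xi : R -> 'cV[R]_k) (u : R -> 'cV[R]_m) : Prop :=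
  evolves x (fun t => pA P *m x t + pB P *m u t) /\
  controlled K (fun t => pC P *m x t) r xi u.

Definition partial_coordinates (R : realType) (n k : nat)
    (T : 'M[R]_(k, n + k)) : Prop :=
  col_mx (row_mx (1%:M : 'M[R]_n) (0 : 'M[R]_(n, k))) T \in unitmx.

(* Parameter-independent realizable controller: a single controller Khat,
   chosen before theta, realizes K theta in the coordinates T theta [x; xi]
   along all closed-loop motions, with the same closed-loop transfer matrix. *)
Definition PIRC (R : realType) (d m p q n k : nat)
    (P : 'cV[R]_d -> plant R m p n)
    (K : 'cV[R]_d -> controller R p q m k) : Prop :=
  exists (T : 'cV[R]_d -> 'M[R]_(k, n + k)) (Khat : controller R p q m k),
  forall theta : 'cV[R]_d,
    [/\ partial_coordinates (T theta),
        forall r x xi u, bounded_signal r ->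
          closed_loop_motion (P theta) (K theta) r x xi u ->
          controlled Khat (fun t => pC (P theta) *m x t) r
            (fun t => T theta *m col_mx (x t) (xi t)) u
      & transfer (closed_loop (P theta) Khat) =
        transfer (closed_loop (P theta) (K theta))].

Definition hurwitz_mx (R : realType) (n : nat) (A : 'M[R]_n) : Prop :=
  forall z : R[i],
    eigenvalue (map_mx (fun a => real_complex R a) A) z -> complex.Re z < 0.

Definition stable_poly (R : realType) (f : {poly R}) : Prop :=
  forall z : R[i],
    root (map_poly (fun a => real_complex R a) f) z -> complex.Re z < 0.

Definition companion (R : realType) (n : nat) (a : 'cV[R]_n) : 'M[R]_n :=
  \matrix_(i, j)
    if i.+1 == n then - a j ord0 else (i.+1 == j :> nat)%:R.

Definition last_basis (R : realType) (n : nat) : 'cV[R]_n :=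
  \col_i (i.+1 == n)%:R.

Definition mrac_plant (R : realType) (n : nat) (am : 'cV[R]_n)
    (theta : 'cV[R]_n) : plant R 1 n n :=
  Plant (companion am - last_basis R n *m theta^T) (last_basis R n) 1%:M.

Definition classical_controller (R : realType) (n : nat)
    (theta : 'cV[R]_n) : controller R n 1 1 0 :=
  Controller 0 0 0 (row_mx theta^T 1%:M).

Definition filtered_controller (R : realType) (n k : nat)
    (Af : 'M[R]_k) (bf cf : 'cV[R]_k)
    (theta : 'cV[R]_n) : controller R n 1 1 k :=
  Controller Af (bf *m row_mx theta^T 1%:M) cf^T 0.

(* Main.v *)
Require Import Defs.
From mathcomp Require Import all_boot all_order all_algebra.
From mathcomp Require Import fraction complex.
From mathcomp Require Import all_classical all_reals all_analysis.
From mathcomp Require Import ring.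

Set Implicit Arguments.
Unset Strict Implicit.
Unset Printing Implicit Defensive.

Import Order.TTheory GRing.Theory Num.Theory.
Import numFieldNormedType.Exports.

Local Open Scope ring_scope.

(** The plant reads x' = Am x + b (u - theta^T x), so theta enters only through
    the scalar theta^T x, in the direction b of the input.

    (a) A static controller has no state to change coordinates on, so a
    realization of the classical controller would be a fixed output law
    u = D [x; r] that agrees with theta^T x + r on every closed-loop motion.
    The closed loop x' = Am x + b r has, whatever theta, the equilibrium
    x = e_1 under the constant reference r = a_1; there u = theta_1 + a_1
    changes with theta while D [x; r] does not.

    (b) Let L be a left inverse of b, for instance b^T when b = e_n.  The plant
    equation gives theta^T x = L Am x + u - L x', so the filter input
    bf (theta^T x + r) is known up to the derivative of bf L x.  Moving that
    derivative to the left-hand side, chi = xi + bf L x obeys an equation in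
    which theta has cancelled:
      chi' = (Af + bf cf^T) chi + (T1 Am - (Af + bf cf^T) T1) x + bf r,
      u = cf^T chi - cf^T T1 x,                        with T1 = bf L.
    The two closed loops are conjugate by [x; xi] |-> [x; chi], hence have the
    same transfer matrix ([transfer_conj]).  This change of coordinates does
    not itself depend on theta. *)

(** The determinant of s I - A is the characteristic polynomial, which is monic
    and so is not zero as a rational function. *)
Lemma resolvent_unit (R : realType) (n : nat) (A : 'M[R]_n) :
  (rat_poly 'X)%:M - rat_mx A \in unitmx.
Proof.
have -> : (rat_poly 'X)%:M - rat_mx A =
    map_mx (@FracField.tofrac {poly R}) (char_poly_mx A).
  by rewrite map_mxB map_scalar_mx -map_mx_comp.
by rewrite unitmxE det_map_mx unitfE tofrac_eq0 monic_neq0 ?char_poly_monic.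
Qed.

Lemma rat_mxM (R : realType) (m n p : nat) (A : 'M[R]_(m, n))
    (B : 'M[R]_(n, p)) :
  rat_mx (A *m B) = rat_mx A *m rat_mx B.
Proof.
exact: (@map_mxM _ _ (@FracField.tofrac {poly R} \o @polyC R)).
Qed.

(** An intertwining S of the state matrices also intertwines the resolvents, so
    that it cancels between output and input, even when S is rectangular. *)
Lemma transfer_conj (R : realType) (m p n n' : nat) (P : plant R m p n)
    (P' : plant R m p n') (S : 'M[R]_(n', n)) :
  pA P' *m S = S *m pA P -> pB P' = S *m pB P -> pC P' *m S = pC P ->
  transfer P' = transfer P.
Proof.
move=> hA hB hC; rewrite /transfer hB -hC !rat_mxM -!mulmxA; congr (_ *m _).
rewrite !mulmxA; congr (_ *m _).
apply: (canLR (mulKmx (resolvent_unit _))); rewrite mulmxA.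
apply: (canRL (mulmxK (resolvent_unit _))).
by rewrite mulmxBr mulmxBl -!rat_mxM hA scalar_mxC.
Qed.

Lemma evolves_mulmx (R : realType) (m n : nat) (M : 'M[R]_(m, n))
    (x v : R -> 'cV[R]_n) :
  evolves x v -> evolves (fun t => M *m x t) (fun t => M *m v t).
Proof.
move=> [xc [E [cE xd]]]; split=> [i t|].
  have -> : (fun s => (M *m x s) i ord0) =
      (fun s => \sum_j M i j * x s j ord0).
    by apply/funext => s; rewrite mxE.
  apply: (cvg_big _ (x0 := 0)) => [|j _].
    exact: add_continuous.
  apply: cvgMl_tmp; exact: xc.
exists E; split=> // i t t0 Et; rewrite mxE.
have -> : (fun s => (M *m x s) i ord0) =
    \sum_j (fun s => M i j * x s j ord0).
  by apply/funext => s; rewrite mxE fct_sumE.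
by apply: is_derive_sum => j; apply: is_deriveZ; exact: xd.
Qed.

Lemma evolves_col_mx (R : realType) (m n : nat) (x v : R -> 'cV[R]_m)
    (y w : R -> 'cV[R]_n) :
  evolves x v -> evolves y w ->
  evolves (fun t => col_mx (x t) (y t)) (fun t => col_mx (v t) (w t)).
Proof.
move=> [xc [E [cE xd]]] [yc [F [cF yd]]]; split.
  move=> i; case: (split_ordP i) => j ->.
    suff -> : (fun t => col_mx (x t) (y t) (lshift n j) ord0) =
        (fun t => x t j ord0) by exact: xc.
    by apply/funext => t; rewrite col_mxEu.
  suff -> : (fun t => col_mx (x t) (y t) (rshift m j) ord0) =
      (fun t => y t j ord0) by exact: yc.
  by apply/funext => t; rewrite col_mxEd.
exists (E `|` F)%classic; split.
  by rewrite -bigcup2E; apply: bigcup_countable => // -[|[|k]] _ //=.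
move=> i t t0 /not_orP[Et Ft]; case: (split_ordP i) => j ->.
  by rewrite col_mxEu; under eq_fun do rewrite col_mxEu; exact: xd.
by rewrite col_mxEd; under eq_fun do rewrite col_mxEd; exact: yd.
Qed.

Lemma eq_evolves (R : realType) (n : nat) (x v w : R -> 'cV[R]_n) :
  (forall t, 0 <= t -> v t = w t) -> evolves x v -> evolves x w.
Proof.
move=> vw [xc [E [cE xd]]]; split=> //; exists E; split=> // i t t0 Et.
by rewrite -vw ?ltW//; exact: xd.
Qed.

Lemma evolves_cst (R : realType) (n : nat) (x : 'cV[R]_n) :
  evolves (fun=> x) (fun=> 0).
Proof.
split=> [i|]; first by move=> t; exact: cvg_cst.
by exists set0; split=> // i t _ _; rewrite mxE; exact: is_derive_cst.
Qed.

(** Along chi = xi + T1 x the term theta^T x arrives with coefficient -T1 b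
    from the plant and bf from the filter; T1 = bf L makes the two cancel. *)
Lemma filtered_controller_PIRC (R : realType) (n k : nat) (Am : 'M[R]_n)
    (b : 'cV[R]_n) (L : 'rV[R]_n) (Af : 'M[R]_k) (bf cf : 'cV[R]_k) :
  L *m b = 1%:M ->
  PIRC (fun theta : 'cV[R]_n => Plant (Am - b *m theta^T) b 1%:M)
       (@filtered_controller R n k Af bf cf).
Proof.
move=> Lb; pose T1 := bf *m L; pose Ah := Af + bf *m cf^T.
have T1b : T1 *m b = bf by rewrite -mulmxA Lb mulmx1.
exists (fun=> row_mx T1 1%:M).
exists (Controller Ah (row_mx (T1 *m Am - Ah *m T1) bf)
                   cf^T (row_mx (- (cf^T *m T1)) 0)) => theta.
(* the coefficient of x in chi', expressed in the old coordinates *)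
have T1A : T1 *m (Am - b *m theta^T) + bf *m theta^T = T1 *m Am.
  by rewrite mulmxBr mulmxA T1b subrK.
split.
- by rewrite /partial_coordinates unitmxE (det_lblock 1%:M) !det1 mulr1 unitr1.
- move=> r x xi u _ [/= xE [/= xiE uE]].
  have {}uE t : 0 <= t -> u t = cf^T *m xi t.
    by move=> /uE ->; rewrite mul0mx addr0.
  split=> /=.
    apply: eq_evolves (evolves_mulmx _ (evolves_col_mx xE xiE)) => t t0.
    rewrite /= uE // -T1A /Ah !mul1mx -mulmxA !mul_row_col !mul1mx.
    rewrite !(mulmxDr, mulmxDl, mulmxBl, mulmxBr, mulmxN, mulNmx, mulmxA) !T1b.
    by apply/matrixP => i j; rewrite !mxE; ring.
  move=> t t0; rewrite uE // !mul_row_col !mul1mx mul0mx addr0 mulmxDr.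
  by rewrite mulNmx mulmxA addrAC subrr add0r.
- apply: (@transfer_conj _ _ _ _ _ _ _ (block_mx 1%:M 0 T1 1%:M)) => /=.
  + rewrite !mulmx_block mul_mx_row !row_mxKl !linear0 !mulmx1 !mul1mx.
    rewrite !mul0mx !addr0 !add0r T1A mulmxN !mulmxA subrK addrNK.
    by rewrite T1b [bf *m _ + Af]addrC.
  + rewrite mul_mx_row !row_mxKr !linear0 mul_block_col !mulmx1.
    by rewrite !mul1mx !mul0mx addr0 mulmx0 add0r.
  + by rewrite mul_row_block !mulmx1 !mulmx0 !mul0mx !addr0.
Qed.

(** The equilibrium x = e_1 of x' = Am x + b r for r = a_1: the first column of
    the companion matrix is -a_1 e_n, also when n = 1. *)
Lemma companion_equilibrium (R : realType) (n : nat) (am : 'cV[R]_n)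
    (i0 : 'I_n) : i0 = 0%N :> nat ->
  companion am *m delta_mx i0 ord0 + last_basis R n *m (am i0 ord0)%:M = 0.
Proof.
move=> i00; rewrite -colE; apply/matrixP => i j; rewrite !ord1 !mxE big_ord1.
rewrite !mxE eqxx mulr1n i00.
by case: ifP => _; rewrite ?mul1r ?addNr ?mul0r ?addr0.
Qed.

Lemma classical_controller_not_PIRC (R : realType) (n : nat) (am : 'cV[R]_n) :
  (0 < n)%N -> ~ PIRC (mrac_plant am) (@classical_controller R n).
Proof.
move=> n0 [T [Kh KhP]].
pose i0 := Ordinal n0; pose e : 'cV[R]_n := delta_mx i0 ord0.
pose r : 'cV[R]_1 := (am i0 ord0)%:M.
have DE theta : theta^T *m e + r = kD Kh *m col_mx e r.
  have [_ /(_ (fun=> r) (fun=> e) (fun=> 0) (fun=> theta^T *m e + r))] :=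
    KhP theta.
  case=> [||_ /(_ 0 (lexx _))].
  - by exists `|am i0 ord0| => t i _; rewrite !ord1 mxE eqxx mulr1n.
  - split=> /=.
      apply: eq_evolves (evolves_cst e) => t _.
      rewrite mulmxBl mulmxDr addrA -mulmxA subrK.
      by rewrite companion_equilibrium.
    split=> /=.
      by apply: eq_evolves (evolves_cst 0) => t _; apply/matrixP => -[].
    by move=> t _; rewrite mul0mx add0r mul1mx mul_row_col mul1mx.
  by rewrite [kC Kh]thinmx0 mul0mx add0r mul1mx.
have := DE e; rewrite -(DE 0) => /addIr /matrixP /(_ ord0 ord0).
rewrite trmx0 mul0mx trmx_delta mul_delta_mx !mxE !eqxx.
by apply/eqP; exact: oner_neq0.
Qed.

Lemma last_basis_normalized (R : realType) (n : nat) :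
  (0 < n)%N -> (last_basis R n)^T *m last_basis R n = 1%:M.
Proof.
case: n => // n _; apply/matrixP => i j; rewrite !ord1 !mxE eqxx.
rewrite (bigD1 ord_max) //= big1 ?addr0 => [|k kn]; rewrite !mxE /=.
  by rewrite eqxx mulr1.
by rewrite eqSS (negbTE (kn : k != n :> nat)) mul0r.
Qed.

Theorem proposition1 (R : realType) (n : nat) (am : 'cV[R]_n)
    (n_gt0 : (0 < n)%N)
    (am_gt0 : forall i, 0 < am i ord0)
    (Am_hurwitz : hurwitz_mx (companion am)) :
  ~ PIRC (mrac_plant am) (@classical_controller R n)
  /\
  (forall (Nf Df : {poly R}) (nxi : nat)
      (Af : 'M[R]_nxi) (bf cf : 'cV[R]_nxi),
    coprimep Nf Df ->
    (size Nf < size Df)%N ->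
    stable_poly Df ->
    size Df = nxi.+1 ->
    transfer (Plant Af bf cf^T) = (rat_poly Nf / rat_poly Df)%:M ->
    PIRC (mrac_plant am) (@filtered_controller R n nxi Af bf cf)).
Proof.
split; first exact: classical_controller_not_PIRC.
move=> Nf Df nxi Af bf cf _ _ _ _ _.
exact: filtered_controller_PIRC (last_basis_normalized R n_gt0).
Qed.
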